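(* Let $d\ge 3$ and $n\ge 1$ be integers and let $G$ be a forest on the vertex set $[n]=\{1,\ldots,n\}$. The irreducible decomposition of the variety $\mathrm{OR}_d(\overline{G})\subset(\mathbb{C}^d)^n$ is $$\mathrm{OR}_d(\overline{G})=\bigcup_{S}V_S,$$ where the union ranges over all $G$-admissible subsets $S\subseteq[n]$, i.e. all subsets $S\subseteq [n]$ such that for every $i\in S$, $$\bigl|N_G(i)\cap([n]\setminus S)\bigr|\ge d\quad\text{and}\quad N_G(i)\cap([n]\setminus S)\not\subseteq N_G(j)\cap([n]\setminus S)\ \text{ for every } j\in[n]\setminus S.$$ That is, the sets $V_S$ with $S$ $G$-admissible are precisely the irreducible components of $\mathrm{OR}_d(\overline{G})$, with distinct admissible $S$ giving distinct components.
   Context: A forest is a finite simple graph without cycles. $E(G)$ is the edge set of $G$ and $N_G(i)$ is the set of neighbors of $i$ in $G$. For $v,w\in\mathbb{C}^d$ put $v\cdot w=\sum_{k=1}^d v_kw_k$ (the bilinear, not Hermitian, product). The variety $\mathrm{OR}_d(\overline{G})\subset(\mathbb{C}^d)^n$ is the set of all tuples $(v_1,\ldots,v_n)$ with $v_i\cdot v_j=0$ whenever $\{i,j\}\in E(G)$. For $S\subseteq[n]$, $U(S)$ is the set of all $(v_1,\ldots,v_n)\in\mathrm{OR}_d(\overline{G})$ such that $v_i=0$ if and only if $i\in S$, and $V_S=\overline{U(S)}$ is its Zariski closure in $\mathbb{C}^{nd}$. *)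

(* Defs.v *)
From HB Require Import structures.
From mathcomp Require Import all_boot all_order all_algebra.
From mathcomp Require Import boolp classical_sets reals complex mpoly.

Set Implicit Arguments.
Unset Strict Implicit.
Unset Printing Implicit Defensive.

Import GRing.Theory.

Local Open Scope classical_set_scope.
Local Open Scope ring_scope.

Definition simple_graph (n : nat) (e : rel 'I_n) : Prop :=
  ssrbool.symmetric e /\ irreflexive e.

(* Cycles have length at least 3: [ucycle e [:: i; j]] also
   holds for every edge {i, j}. *)
Definition forest (n : nat) (e : rel 'I_n) : Prop :=
  simple_graph e /\
  ~ exists c : seq 'I_n, (3 <= size c)%N /\ ucycle e c.

Definition neighbors (n : nat) (e : rel 'I_n) (i : 'I_n) : {set 'I_n} :=
  [set j | e i j]%SET.

Definition admissible (d n : nat) (e : rel 'I_n) (S : {set 'I_n}) : Prop :=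
  forall i : 'I_n, i \in S ->
    (d <= #|neighbors e i :&: ~: S|)%N /\
    (forall j : 'I_n, j \in ~: S ->
       ~~ (neighbors e i :&: ~: S \subset neighbors e j :&: ~: S)).

(* A tuple (v_1, ..., v_n) of vectors of C^d is the n x d matrix with rows v_i;
   polynomials in its entries are read through [mxvec]. *)

Definition zeros (C : comNzRingType) (n d : nat)
    (I : set {mpoly C[n * d]}) : set 'M[C]_(n, d) :=
  [set v | forall p, I p -> p.@[mxvec v 0] = 0].

Definition zariski_closed (C : comNzRingType) (n d : nat)
    (Z : set 'M[C]_(n, d)) : Prop :=
  exists I : set {mpoly C[n * d]}, Z = zeros I.

Definition zariski_closure (C : comNzRingType) (n d : nat)
    (A : set 'M[C]_(n, d)) : set 'M[C]_(n, d) :=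
  smallest (@zariski_closed C n d) A.

Definition zariski_irreducible (C : comNzRingType) (n d : nat)
    (Z : set 'M[C]_(n, d)) : Prop :=
  Z !=set0 /\
  forall A B : set 'M[C]_(n, d), zariski_closed A -> zariski_closed B ->
    Z `<=` A `|` B -> Z `<=` A \/ Z `<=` B.

Definition irreducible_component (C : comNzRingType) (n d : nat)
    (X Z : set 'M[C]_(n, d)) : Prop :=
  [/\ zariski_closed Z, zariski_irreducible Z, Z `<=` X &
      forall Y : set 'M[C]_(n, d), zariski_closed Y -> zariski_irreducible Y ->
        Z `<=` Y -> Y `<=` X -> Y = Z].

Definition dot (C : comNzRingType) (d : nat) (v w : 'rV[C]_d) : C :=
  \sum_(k < d) v 0 k * w 0 k.

(* OR_d of the complement of the graph e: orthogonality is imposed along the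
   edges of e itself. *)
Definition ORbar (C : comNzRingType) (d n : nat) (e : rel 'I_n) :
    set 'M[C]_(n, d) :=
  [set v | forall i j : 'I_n, e i j -> dot (row i v) (row j v) = 0].

Arguments ORbar C d {n} e.

Definition U (C : comNzRingType) (d n : nat) (e : rel 'I_n) (S : {set 'I_n}) :
    set 'M[C]_(n, d) :=
  [set v | ORbar C d e v /\ forall i : 'I_n, row i v = 0 <-> i \in S].

Arguments U C d {n} e S.

Definition V (C : comNzRingType) (d n : nat) (e : rel 'I_n) (S : {set 'I_n}) :
    set 'M[C]_(n, d) :=
  zariski_closure (U C d e S).

Arguments V C d {n} e S.

(* Main.v *)
Require Import Defs.
From HB Require Import structures.
From mathcomp Require Import all_boot all_order all_algebra.
From mathcomp Require Import boolp classical_sets reals complex mpoly.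

Set Implicit Arguments.
Unset Strict Implicit.
Unset Printing Implicit Defensive.

Import Order.TTheory GRing.Theory Num.Theory.

Local Open Scope classical_set_scope.
Local Open Scope ring_scope.

(* Any two points of [U S] are joined by a polynomial curve in the vanishing
   locus of the rows of [S] inside [ORbar]: removing a leaf of the forest at a
   time, a curve at a vertex extends to its leaf because the orthogonal
   complement of a nonzero vector is polynomially parametrized. Pulled back to
   this curve, two polynomials nonzero somewhere on [U S] become nonzero
   univariate polynomials, so [U S] is irreducible.

   If [S] is not admissible at [i], every point of [U S] admits a nonzero
   vector [w] orthogonal to all neighbors of [i], and moving row [i] along
   [t w] shows that [V S] lies in [V (S :\ i)]; hence the admissible strata
   cover.

   Conversely, let [S] be admissible and [i] in [S] but not in [T]. On [U T] the
   neighbors of [i] are orthogonal to a nonzero vector, so any [d] of them have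
   zero determinant. On [U S] the determinant of [d] neighbors outside [S] can
   be nonzero: these lie in distinct components of the forest induced on the
   complement of [S], and each component can be filled with its own member of a
   basis of isotropic vectors. *)

(** * Nonvanishing of and substitution by univariate polynomials *)

Lemma poly_neq0_nonroot (C : numDomainType) (p : {poly C}) :
  p != 0 -> exists t, p.[t] != 0.
Proof.
move=> p0; apply: contrapT => /forallNP p_root.
have : all (root p) [seq i%:R | i <- iota 0 (size p)].
  by apply/allP => t _; apply/eqP; apply: contrapT => /eqP /p_root.
move=> /(max_poly_roots p0); rewrite size_map size_iota ltnn => /(_ _)/notF.
by apply; rewrite map_inj_uniq ?iota_uniq //; apply: mulrIn; apply: oner_neq0.
Qed.

Lemma meval_poly (C : comNzRingType) (m : nat) (f : {mpoly C[m]})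
    (h : 'I_m -> {poly C}) :
  exists q : {poly C}, forall t, q.[t] = f.@[fun k => (h k).[t]].
Proof.
exists (\sum_(l <- msupp f) (f@_l)%:P * \prod_i h i ^+ l i) => t.
rewrite mevalE horner_sum; apply: eq_bigr => l _.
rewrite hornerM hornerC horner_prod; congr (_ * _).
by apply: eq_bigr => i _; rewrite horner_exp.
Qed.

(** * Zariski-closed sets of tuples *)

Section Zariski.
Variables (C : comNzRingType) (n d : nat).
Implicit Types (A B : set 'M[C]_(n, d)) (v : 'M[C]_(n, d)).

Definition peval (f : {mpoly C[n * d]}) v : C := f.@[mxvec v 0].

Definition coordX (i : 'I_n) (k : 'I_d) : {mpoly C[n * d]} :=
  'X_(mxvec_index i k).

Lemma peval_coordX v i k : peval (coordX i k) v = v i k.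
Proof. by rewrite /peval mevalXU mxvecE. Qed.

Lemma peval_curve (f : {mpoly C[n * d]}) (p : 'M[{poly C}]_(n, d)) :
  exists q : {poly C}, forall t, q.[t] = peval f (map_mx (horner_eval t) p).
Proof.
have [q qE] := meval_poly f (fun k => mxvec p 0 k).
exists q => t; rewrite qE /peval; apply: meval_eq => k.
by case/mxvec_indexP: k => i j; rewrite !mxvecE mxE.
Qed.

Lemma zariski_closedI (A : set (set 'M[C]_(n, d))) :
  (forall Z, A Z -> zariski_closed Z) -> zariski_closed (\bigcap_(Z in A) Z).
Proof.
(* All polynomials vanishing on some member serve as equations, so none has to be chosen for each
   member. *)
move=> Acl; exists [set f | exists2 Z, A Z & forall v, Z v -> peval f v = 0].
apply/seteqP; split=> [v Av f [Z AZ] | v Av Z AZ]; first by apply; apply: Av.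
have [I ZE] := Acl Z AZ; rewrite ZE => f If; apply: Av; exists Z => // w.
by rewrite ZE; apply.
Qed.

Lemma zariski_closed_closure A : zariski_closed (zariski_closure A).
Proof. by apply: zariski_closedI => Z []. Qed.

Lemma sub_zariski_closure A : A `<=` zariski_closure A.
Proof. by move=> v Av Z [_]; apply. Qed.

Lemma zariski_closure_min A B :
  zariski_closed B -> A `<=` B -> zariski_closure A `<=` B.
Proof. by move=> Bcl AB v; apply. Qed.

Lemma zariski_closure_separation A Z :
  zariski_closed Z -> ~ zariski_closure A `<=` Z ->
  exists a f, [/\ A a, forall v, Z v -> peval f v = 0 & peval f a <> 0].
Proof.
move=> Zcl AZ; apply: contrapT => no; apply: AZ.
apply: zariski_closure_min => // a Aa; move: Zcl no => [I ->] no f If.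
apply: contrapT => fa; apply: no; exists a, f; split=> // v; exact.
Qed.

Lemma zariski_closed_row0 i :
  zariski_closed [set v : 'M[C]_(n, d) | row i v = 0].
Proof.
exists [set f | exists k, f = coordX i k].
apply/seteqP; split=> [v /rowP vi0 _ [k ->] | v vi0].
  by rewrite -/(peval _ _) peval_coordX; have := vi0 k; rewrite !mxE.
apply/rowP => k; rewrite !mxE -(peval_coordX v i k).
by apply: vi0; exists k.
Qed.

Lemma zariski_closed_ORbar (e : rel 'I_n) : zariski_closed (ORbar C d e).
Proof.
have dotE v i j :
    peval (\sum_(k < d) coordX i k * coordX j k) v = dot (row i v) (row j v).
  rewrite /peval raddf_sum; apply: eq_bigr => k _.
  by rewrite /= mevalM -!/(peval _ _) !peval_coordX !mxE.
exists [set f | exists i j, e i j /\ f = \sum_(k < d) coordX i k * coordX j k].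
apply/seteqP; split=> [v vO _ [i [j [eij ->]]] | v vO i j eij].
  by rewrite -/(peval _ _) dotE; apply: vO.
by rewrite -dotE; apply: vO; exists i, j.
Qed.

Lemma zariski_closed_det (j : 'I_d -> 'I_n) :
  zariski_closed [set v : 'M[C]_(n, d) | \det (rowsub j v) = 0].
Proof.
pose f := \det (\matrix_(k, l) coordX (j k) l).
have fE v : peval f v = \det (rowsub j v).
  rewrite /peval -det_map_mx; congr (\det _); apply/matrixP => k l.
  by rewrite !mxE [LHS]peval_coordX.
exists [set f]; apply/seteqP; split=> v /=.
  by move=> v0 _ ->; rewrite -/(peval _ _) fE.
by move=> /(_ f erefl); rewrite -/(peval _ _) fE.
Qed.

End Zariski.

Lemma zariski_closedU (C : idomainType) (n d : nat) (A B : set 'M[C]_(n, d)) :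
  zariski_closed A -> zariski_closed B -> zariski_closed (A `|` B).
Proof.
move=> [I ->] [J ->].
exists [set h | exists f g, [/\ I f, J g & h = f * g]].
apply/seteqP; split=> v.
  by move=> vIJ _ [f [g [If Jg ->]]]; rewrite mevalM;
    case: vIJ => [/(_ f If)|/(_ g Jg)] ->; rewrite ?mul0r ?mulr0.
move=> vIJ; apply: contrapT => /not_orP[/existsNP[f /not_implyP[If f0]]].
move=> /existsNP[g /not_implyP[Jg g0]].
have /eqP : (f * g).@[mxvec v 0] = 0 by apply: vIJ; exists f, g.
by rewrite mevalM mulf_eq0 => /orP[] /eqP.
Qed.

Lemma zariski_closed_bigU (C : idomainType) (n d : nat) (K : eqType) (s : seq K)
    (A : K -> set 'M[C]_(n, d)) :
  (forall k, zariski_closed (A k)) ->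
  zariski_closed [set v | exists2 k, k \in s & A k v].
Proof.
move=> Acl; elim: s => [|k s IHs].
  exists [set 1]; apply/seteqP; split=> [v []//|v /(_ 1 erefl)/eqP].
  by rewrite meval1 oner_eq0.
suff -> : [set v | exists2 l, l \in k :: s & A l v] =
    A k `|` [set v | exists2 l, l \in s & A l v] by exact: zariski_closedU.
apply/seteqP; split=> [v [l]|v [Akv|[l ls Alv]]].
- by rewrite inE => /predU1P[->|ls] Alv; [left|right; exists l].
- by exists k; rewrite ?mem_head.
- by exists l; rewrite // inE ls orbT.
Qed.

Lemma zariski_irreducible_sub (C : idomainType) (n d : nat) (K : eqType)
    (s : seq K) (A : K -> set 'M[C]_(n, d)) (Z : set 'M[C]_(n, d)) :
  (forall k, zariski_closed (A k)) -> zariski_irreducible Z ->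
  Z `<=` [set v | exists2 k, k \in s & A k v] ->
  exists2 k, k \in s & Z `<=` A k.
Proof.
move=> Acl [[v0 Zv0] Zirr]; elim: s => [|k s IHs] Zs.
  by have [] := Zs _ Zv0.
have [|Zk|] := Zirr _ _ (Acl k) (zariski_closed_bigU s Acl).
- move=> v /Zs[l]; rewrite inE => /predU1P[->|ls] Alv; first by left.
  by right; exists l.
- by exists k; rewrite ?mem_head.
- by move=> /IHs[l ls Zl]; exists l; rewrite // inE ls orbT.
Qed.

(** If [f] vanishes on [A], its pullback [F] to the curve satisfies [q * F = 0] at every parameter,
    so [F = 0] and [f] vanishes even at the roots of [q]. *)
Lemma curve_zariski_closure (C : numDomainType) (n d : nat)
    (A : set 'M[C]_(n, d)) (p : 'M[{poly C}]_(n, d)) (q : {poly C}) (t : C) :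
  q != 0 -> (forall s, q.[s] != 0 -> A (map_mx (horner_eval s) p)) ->
  zariski_closure A (map_mx (horner_eval t) p).
Proof.
move=> q0 qA Z [[I ->] AI] f If.
have [F FE] := peval_curve f p.
rewrite -/(peval _ _) -FE.
suff -> : F = 0 by rewrite horner0.
apply/eqP; apply: contraT => F0.
have [|s] := @poly_neq0_nonroot _ (q * F); first by rewrite mulf_neq0.
rewrite hornerM mulf_eq0 negb_or => /andP[/qA/AI/(_ f If) fs0].
by rewrite FE /peval fs0 eqxx.
Qed.

(** * Leaves and cycles in forests *)

Section Forest.
Variables (n : nat) (e : rel 'I_n).
Hypothesis e_forest : forest e.
Implicit Types (D : {set 'I_n}).

Let e_sym : ssrbool.symmetric e. Proof. by case: e_forest => -[]. Qed.
Let e_irr : irreflexive e. Proof. by case: e_forest => -[]. Qed.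

(** Without a leaf, a simple path in [D] could always be prolonged at its head, since a step back
    onto the path closes a cycle; it would end up with more than [n] vertices. *)
Lemma forest_leaf D :
  (0 < #|D|)%N ->
  exists2 w, w \in D & (#|neighbors e w :&: D| <= 1)%N.
Proof.
move=> /card_gt0P[x0 x0D]; apply: contrapT => noleaf.
have deg2 w z : w \in D -> exists y, [/\ y \in D, e w y & y != z].
  move=> wD; apply: contrapT => /forallNP no; apply: noleaf; exists w => //.
  rewrite -(cards1 z) subset_leq_card //; apply/fintype.subsetP => y.
  rewrite !inE => /andP[wy yD]; apply: contrapT => /negP yz.
  by apply: (no y); split.
have long k : exists x p, [/\ path e x p, uniq (x :: p), size p = k &
    all (mem D) (x :: p)].
  elim: k => [|k [x [p [xp up sp Dp]]]].
    by exists x0, [::]; rewrite /= x0D.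
  have xD : x \in D by case/andP: Dp.
  (* Avoiding the head of [p] forbids going straight back, so a return to [p] gives a cycle of
     length at least 3; for empty [p] the default [x] is harmless. *)
  have [y [yD xy y_head]] := deg2 x (head x p) xD.
  have [yp|yNp] := boolP (y \in p); last first.
    exists y, (x :: p); split; rewrite ?sp //=.
    - by rewrite e_sym xy.
    - move: up => /= ->; rewrite inE negb_or yNp !andbT.
      by apply: contraTneq xy => ->; rewrite e_irr.
    - by rewrite sp.
    - by rewrite yD.
  case: e_forest => _ []; exists (x :: take (index y p).+1 p); split.
    case: p yp {xp up sp Dp} y_head => // z p.
    rewrite inE => /predU1P[-> /=|yp /= yz]; first by rewrite eqxx.
    by rewrite [z == y]eq_sym (negPf yz) /= size_takel // index_mem.
  have last_y : last x (take (index y p).+1 p) = y.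
    by rewrite -nth_last size_takel ?index_mem //= nth_take // nth_index.
  apply/andP; split.
    by rewrite /= rcons_path last_y e_sym xy andbT take_path.
  by move: up; rewrite /= => /andP[xNp /take_uniq ->]; rewrite andbT;
    apply: contra xNp => /mem_take.
have [x [p [_ up sp _]]] := long n.
by have := uniq_leq_size up (fun y _ => mem_enum 'I_n y);
  rewrite /= sp size_enum_ord ltnn.
Qed.

(** Otherwise a simple path from [j] to [j'] inside [D], closed up through [i], is a cycle; [i] lies
    outside [D], so it is not repeated. *)
Lemma forest_connect_neighbors D i j j' :
  i \notin D -> e i j -> e i j' -> j \in D ->
  connect [rel x y | [&& e x y, x \in D & y \in D]] j j' -> j = j'.
Proof.
move=> iND ij ij' jD /connectP[p0 jp0 j'E]; subst j'.
case/shortenP: jp0 ij' => p jp up _ ij'.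
apply: contrapT => jj'; case: e_forest => _ []; exists (i :: j :: p).
have pD : {subset j :: p <= D}.
  elim: p j jD jp {up ij ij' jj'} => [|y p IHp] x xD /=.
    by move=> _ z; rewrite inE => /eqP->.
  move=> /andP[/and3P[_ _ yD] yp] z; rewrite inE => /predU1P[->//|].
  exact: IHp yD yp z.
split; first by case: p jj' {jp up ij' pD}.
apply/andP; split; last first.
  by rewrite cons_uniq up andbT; apply: contra iND => /pD.
rewrite /= ij rcons_path /= [e _ i]e_sym ij' andbT.
by apply: sub_path jp => x y /and3P[].
Qed.

End Forest.

(** * The bilinear product *)

Section Dot.
Variables (C : comNzRingType) (d : nat).
Implicit Types (u v w : 'rV[C]_d).

Lemma dotC v w : dot v w = dot w v.
Proof. by apply: eq_bigr => k _; rewrite mulrC. Qed.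

Lemma dotDl u v w : dot (u + v) w = dot u w + dot v w.
Proof. by rewrite -big_split; apply: eq_bigr => k _; rewrite mxE mulrDl. Qed.

Lemma dotZl a v w : dot (a *: v) w = a * dot v w.
Proof.
by rewrite /dot mulr_sumr; apply: eq_bigr => k _; rewrite mxE mulrA.
Qed.

Lemma dot0l v : dot 0 v = 0.
Proof. by rewrite -(scale0r v) dotZl mul0r. Qed.

Lemma dot0r v : dot v 0 = 0.
Proof. by rewrite dotC dot0l. Qed.

Lemma dot_delta k v : dot (delta_mx 0 k) v = v 0 k.
Proof.
rewrite /dot (bigD1 k) //= mxE !eqxx mul1r big1 ?addr0 // => l lk.
by rewrite mxE (negPf lk) andbF mul0r.
Qed.

Lemma dot_mul m v (A : 'M_(m, d)) j : dot v (row j A) = (v *m A^T) 0 j.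
Proof. by rewrite mxE; apply: eq_bigr => k _; rewrite !mxE. Qed.

Lemma dot_perp u w v : dot (dot u v *: w - dot w v *: u) v = 0.
Proof. by rewrite -scaleNr dotDl !dotZl mulNr mulrC subrr. Qed.

End Dot.

Lemma dot_map (C D : comNzRingType) (d : nat) (f : {rmorphism C -> D})
    (v w : 'rV[C]_d) : dot (map_mx f v) (map_mx f w) = f (dot v w).
Proof. by rewrite rmorph_sum; apply: eq_bigr => k _; rewrite !mxE rmorphM. Qed.

(** * Polynomial curves of orthogonal tuples *)

Section Curves.
Variables (C : fieldType) (d : nat).

Lemma dot_eq1 (v : 'rV[C]_d) : v != 0 -> exists u, dot u v = 1.
Proof.
move=> /rV0Pn[k vk]; exists ((v 0 k)^-1 *: delta_mx 0 k).
by rewrite dotZl dot_delta mulVf.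
Qed.

Definition segment (a b : 'rV[C]_d) : 'rV[{poly C}]_d :=
  map_mx polyC a + 'X *: map_mx polyC (b - a).

Lemma segment0 a b : map_mx (horner_eval 0) (segment a b) = a.
Proof. by apply/rowP => k; rewrite !mxE /horner_eval !hornerE. Qed.

Lemma segment1 a b : map_mx (horner_eval 1) (segment a b) = b.
Proof.
apply/rowP => k; rewrite !mxE /horner_eval hornerD hornerM hornerX.
by rewrite !hornerC mul1r subrKC.
Qed.

(* Where [v t != 0], the vectors orthogonal to [v t] are exactly those of the
   form [(u . v t) x - (x . v t) u]; the end values of [u] and [x] are chosen
   with [u . v t = 1] and [x] the prescribed value, and interpolated linearly. *)
Lemma perp_curve (v : 'rV[{poly C}]_d) (a b : 'rV[C]_d) :
  map_mx (horner_eval 0) v != 0 -> map_mx (horner_eval 1) v != 0 ->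
  dot a (map_mx (horner_eval 0) v) = 0 ->
  dot b (map_mx (horner_eval 1) v) = 0 ->
  exists q, [/\ map_mx (horner_eval 0) q = a, map_mx (horner_eval 1) q = b &
    dot q v = 0].
Proof.
move=> /dot_eq1[ua ua1] /dot_eq1[ub ub1] av bv.
pose u := segment ua ub; pose x := segment a b.
exists (dot u v *: x - dot x v *: u); split; last exact: dot_perp.
  by rewrite map_mxB !map_mxZ -!dot_map !segment0 ua1 av scale1r scale0r subr0.
by rewrite map_mxB !map_mxZ -!dot_map !segment1 ub1 bv scale1r scale0r subr0.
Qed.

(** Nonvanishing is imposed at the two ends only: rows may vanish in between, and [V_irreducible]
    discards those parameters. *)
Lemma forest_curve (n : nat) (e : rel 'I_n) (D : {set 'I_n})
    (a b : 'I_n -> 'rV[C]_d) :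
  forest e ->
  {in D, forall i, a i != 0} -> {in D, forall i, b i != 0} ->
  {in D &, forall i j, e i j -> dot (a i) (a j) = 0} ->
  {in D &, forall i j, e i j -> dot (b i) (b j) = 0} ->
  exists p : 'I_n -> 'rV[{poly C}]_d,
    [/\ {in D, forall i, map_mx (horner_eval 0) (p i) = a i},
        {in D, forall i, map_mx (horner_eval 1) (p i) = b i} &
        {in D &, forall i j, e i j -> dot (p i) (p j) = 0}].
Proof.
move=> eF; have [[e_sym e_irr] _] := eF.
have [m] := ubnP #|D|; elim: m D => // m IHm D; rewrite ltnS => Dm a0 b0 aO bO.
have [D0|/(forest_leaf eF)[w wD w_leaf]] := posnP #|D|.
  by exists (fun=> 0); split=> i; rewrite (card0_eq D0).
have D'D : {subset D :\ w <= D} by move=> i; rewrite !inE => /andP[].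
have [|||||p [p0 p1 pO]] := IHm (D :\ w)%SET.
- by move: Dm; rewrite (cardsD1 w) wD.
- by move=> i /D'D; apply: a0.
- by move=> i /D'D; apply: b0.
- by move=> i j /D'D iD /D'D; apply: aO.
- by move=> i j /D'D iD /D'D; apply: bO.
(* The leaf has at most one neighbor in [D]: with none a segment will do, with one [perp_curve]
   applies. *)
have [q [q0 q1 qO]] : exists q : 'rV[{poly C}]_d,
    [/\ map_mx (horner_eval 0) q = a w, map_mx (horner_eval 1) q = b w &
        forall j, j \in D -> e w j -> dot q (p j) = 0].
  have [w0|/card_gt0P[j]] := posnP #|neighbors e w :&: D|.
    exists (segment (a w) (b w)); rewrite segment0 segment1; split=> // j jD wj.
    by have := card0_eq w0 j; rewrite !inE wj jD.
  rewrite !inE => /andP[wj jD].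
  have jD' : j \in (D :\ w)%SET.
    by rewrite !inE jD andbT; apply: contraTneq wj => ->; rewrite e_irr.
  have [||||q [q0 q1 qO]] := @perp_curve (p j) (a w) (b w).
  - by rewrite p0 ?a0.
  - by rewrite p1 ?b0.
  - by rewrite p0 ?aO.
  - by rewrite p1 ?bO.
  exists q; split=> // l lD wl.
  suff -> : l = j by [].
  by apply: (card_le1_eqP w_leaf); rewrite !inE ?wl ?wj.
exists (fun i => if i == w then q else p i); split=> [i iD|i iD|i j iD jD].
- by case: eqVneq => [->//|iw]; rewrite p0 // !inE iw.
- by case: eqVneq => [->//|iw]; rewrite p1 // !inE iw.
case: (eqVneq i w) => [->|iw]; case: (eqVneq j w) => [->|jw].
- by rewrite e_irr.
- exact: qO.
- by rewrite e_sym dotC; apply: qO.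
- by apply: pO; rewrite !inE ?iw ?jw.
Qed.

End Curves.

(** * Bases of isotropic vectors *)

Lemma unitmx_row_neq0 (F : fieldType) (m : nat) (A : 'M[F]_m) i :
  A \in unitmx -> row i A != 0.
Proof.
rewrite -row_free_unit => Afree; rewrite rowE mulmx_free_eq0 //.
by apply/rV0Pn; exists i; rewrite mxE !eqxx oner_eq0.
Qed.

(** The basis is [e_0 - 'i e_1] together with [e_0 + 'i e_k] for [k >= 1]. The first of these and
    the one for [k = 1] sum to [2 e_0], and subtracting [e_0] then yields every [e_k]. *)
Lemma isotropic_basis (C : numClosedFieldType) (d : nat) :
  (2 <= d)%N ->
  exists X : 'M[C]_d, X \in unitmx /\ forall k, dot (row k X) (row k X) = 0.
Proof.
case: d => [|[|d]] // _.
pose o1 : 'I_d.+2 := lift ord0 ord0.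
pose x k : 'rV[C]_d.+2 := if k == ord0
  then delta_mx 0 ord0 - 'i *: delta_mx 0 o1
  else delta_mx 0 ord0 + 'i *: delta_mx 0 k.
have x_iso c k : k != ord0 -> c ^+ 2 = -1 :> C ->
    dot (delta_mx 0 ord0 + c *: delta_mx 0 k)
      (delta_mx 0 ord0 + c *: delta_mx 0 k) = 0 :> C.
  move=> k0 c2; rewrite !(dotDl, dotZl, dot_delta) !mxE !eqxx eq_sym (negPf k0).
  by rewrite !mulr0 addr0 add0r !mulr1 -expr2 c2 subrr.
exists (\matrix_k x k); split=> [|k]; last first.
  rewrite rowK /x; case: eqVneq => [_|k0]; last exact: x_iso k0 (sqrCi _).
  by rewrite -scaleNr; apply: x_iso => //; rewrite sqrrN sqrCi.
rewrite -row_full_unit -sub1mx.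
set X := \matrix_k x k.
have xX k : (x k <= X)%MS by rewrite -[x k](rowK x) row_sub.
have e0X : ((delta_mx 0 ord0 : 'rV[C]_d.+2) <= X)%MS.
  suff -> : delta_mx 0 ord0 = 2%:R^-1 *: (x ord0 + x o1).
    by rewrite scalemx_sub // addmx_sub.
  rewrite /x eqxx /= addrACA addNr addr0 -mulr2n -scaler_nat scalerA.
  by rewrite mulVf ?scale1r // pnatr_eq0.
apply/row_subP => k; rewrite row1.
have [->//|k0] := eqVneq k ord0.
suff -> : delta_mx 0 k = 'i^-1 *: (x k - delta_mx 0 ord0).
  by rewrite scalemx_sub // addmx_sub // eqmx_opp.
by rewrite /x (negPf k0) addrAC subrr add0r scalerA mulVf ?scale1r // neq0Ci.
Qed.

(** * Strata and their closures *)

Section Strata.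
Variables (C : numClosedFieldType) (d n : nat) (e : rel 'I_n).
Implicit Types (S T : {set 'I_n}) (v : 'M[C]_(n, d)).

Lemma V_sub_ORbar S : V C d e S `<=` ORbar C d e.
Proof.
by apply: zariski_closure_min => [|v []//]; apply: zariski_closed_ORbar.
Qed.

Lemma U_neq0 S : (2 <= d)%N -> U C d e S !=set0.
Proof.
move=> d2; have [X [Xunit Xiso]] := isotropic_basis C d2.
pose k0 : 'I_d := Ordinal (ltn_trans (ltnSn 0) d2).
have x0 : row k0 X != 0 by exact: unitmx_row_neq0.
(* The same isotropic vector fills every row outside [S], being orthogonal to itself. *)
exists (\matrix_i if i \in S then 0 else row k0 X); split=> [i j _|i].
  by rewrite !rowK; case: ifP; case: ifP; rewrite ?dot0l ?dot0r ?Xiso.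
by rewrite rowK; case: ifP => // _; split=> // x00; rewrite x00 eqxx in x0.
Qed.

Lemma V_irreducible S :
  forest e -> (2 <= d)%N -> zariski_irreducible (V C d e S).
Proof.
move=> eF d2; split.
  by have [v Uv] := U_neq0 S d2; exists v; apply: sub_zariski_closure.
move=> A B Acl Bcl VAB; apply: contrapT => /not_orP[].
move=> /(zariski_closure_separation Acl)[a [f [[aO a0] fA fa]]].
move=> /(zariski_closure_separation Bcl)[b [g [[bO b0] gB gb]]].
have [||||p [p0 p1 pO]] := @forest_curve C d n e (~: S)%SET
    (fun i => row i a) (fun i => row i b) eF.
- by move=> i; rewrite inE; apply: contraNneq => /a0.
- by move=> i; rewrite inE; apply: contraNneq => /b0.
- by move=> i j _ _; apply: aO.
- by move=> i j _ _; apply: bO.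
pose P : 'M[{poly C}]_(n, d) := \matrix_i if i \in S then 0 else p i.
have PS t i : row i (map_mx (horner_eval t) P) =
    if i \in S then 0 else map_mx (horner_eval t) (p i).
  rewrite -map_row rowK; case: ifP => // _.
  by rewrite map_mx0.
have P0 : map_mx (horner_eval 0) P = a.
  apply/row_matrixP => i; rewrite PS; case: ifPn => [/a0->//|iS].
  by rewrite p0 ?inE.
have P1 : map_mx (horner_eval 1) P = b.
  apply/row_matrixP => i; rewrite PS; case: ifPn => [/b0->//|iS].
  by rewrite p1 ?inE.
(* For [i] outside [S], [h i] is a coordinate of the curve at [i] that is nonzero at time 0; row [i]
   can vanish only at its roots. *)
have /boolp.choice[h hP] : forall i, exists q : {poly C}, i \notin S ->
    q != 0 /\ forall t, q.[t] != 0 -> map_mx (horner_eval t) (p i) != 0.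
  move=> i; have [iS|iS] := boolP (i \in S); first by exists 0.
  have : map_mx (horner_eval 0) (p i) != 0.
    by rewrite p0 ?inE //; apply: contraNneq iS => /a0.
  move=> /rV0Pn[k]; rewrite mxE => pik; exists (p i 0 k) => _; split.
    by apply: contraNneq pik => ->; rewrite /horner_eval horner0.
  by move=> t pt; apply/rV0Pn; exists k; rewrite mxE.
have [F FE] := peval_curve f P; have [G GE] := peval_curve g P.
have F0 : F != 0.
  by apply: contra_notN fa => /eqP F0; rewrite -P0 -FE F0 horner0.
have G0 : G != 0.
  by apply: contra_notN gb => /eqP G0; rewrite -P1 -GE G0 horner0.
(* At such a [t] the curve is in [U S], yet in neither [A] nor [B]. *)
have [|t] := @poly_neq0_nonroot _ (F * G * \prod_(i in ~: S) h i).
  rewrite !mulf_neq0 //; apply/prodf_neq0 => i; rewrite inE => iS.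
  by case: (hP i iS).
rewrite !hornerM !mulf_eq0 !negb_or FE GE horner_prod.
move=> /andP[/andP[ft gt] /prodf_neq0 ht].
have Ut : U C d e S (map_mx (horner_eval t) P).
  split=> [i j ij|i]; rewrite !PS.
    case: ifPn => iS; first by rewrite dot0l.
    case: ifPn => jS; first by rewrite dot0r.
    by rewrite dot_map pO ?inE // rmorph0.
  case: ifPn => // iS; split=> // /eqP.
  by rewrite (negPf ((hP i iS).2 t _)) // ht // inE.
case: (VAB _ (sub_zariski_closure Ut)) => [/fA|/gB] /eqP.
  by rewrite (negPf ft).
by rewrite (negPf gt).
Qed.

(** Only neighbors outside [S] constrain [w], since the rows in [S] vanish. The curve leaves the new
    stratum at [t = 0] alone, hence the multiplier ['X]. *)
Lemma V_setD1 S i v (w : 'rV[C]_d) :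
  i \in S -> U C d e S v -> w != 0 ->
  (forall j, e i j -> j \notin S -> dot w (row j v) = 0) ->
  simple_graph e -> V C d e (S :\ i)%SET v.
Proof.
move=> iS [vO v0] w0 wO [e_sym e_irr].
pose p : 'M[{poly C}]_(n, d) :=
  \matrix_j if j == i then 'X *: map_mx polyC w else map_mx polyC (row j v).
have pE t j : row j (map_mx (horner_eval t) p) =
    if j == i then t *: w else row j v.
  apply/rowP => k; rewrite !mxE; case: ifP => _.
    by rewrite !mxE /horner_eval !hornerE.
  by rewrite !mxE /horner_eval !hornerE.
have -> : v = map_mx (horner_eval 0) p.
  apply/row_matrixP => j; rewrite pE; case: eqP => // ->.
  by rewrite scale0r; apply/v0.
apply: (@curve_zariski_closure _ _ _ _ p 'X); rewrite ?polyX_eq0 // => t.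
rewrite hornerX => t0; split=> [j l ejl|j]; rewrite !pE.
  have wO' m : e i m -> dot w (row m v) = 0.
    move=> im; have [mS|] := boolP (m \in S); last exact: wO.
    by have /v0 -> := mS; rewrite dot0r.
  case: eqVneq ejl => [->|ji] ejl; case: eqVneq ejl => [->|li] ejl.
  - by rewrite e_irr in ejl.
  - by rewrite dotZl wO' ?mulr0.
  - by rewrite dotC dotZl wO' ?mulr0 // e_sym.
  - exact: vO.
rewrite !inE; case: eqVneq => [_|ji] /=; last exact: v0.
by split=> // /eqP; rewrite scaler_eq0 (negPf t0) (negPf w0).
Qed.

(** Fewer than [d] rows have rank below [d], so their transpose has a nonzero left kernel. *)
Lemma exists_orthogonal (K : {set 'I_n}) v :
  (#|K| < d)%N ->
  exists w : 'rV[C]_d, w != 0 /\ {in K, forall j, dot w (row j v) = 0}.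
Proof.
move=> Kd; pose M := rowsub (enum_val : 'I_#|K| -> 'I_n) v.
have : kermx M^T != 0.
  by rewrite kermx_eq0 /row_free neq_ltn (leq_ltn_trans (rank_leq_col _)).
move=> /rowV0Pn[w /sub_kermxP wM w0]; exists w; split=> // j jK.
have -> : row j v = row (enum_rank_in jK j) M.
  by rewrite row_rowsub enum_rankK_in.
by rewrite dot_mul wM mxE.
Qed.

(** With fewer than [d] neighbors of [i] outside [S], an orthogonal vector exists by dimension. If
    instead all of them are neighbors of some [j] outside [S], row [j] itself serves and is
    nonzero. *)
Lemma V_nonadmissible S :
  simple_graph e -> ~ admissible d e S ->
  exists2 i, i \in S & V C d e S `<=` V C d e (S :\ i)%SET.
Proof.
move=> eG /existsNP[i /not_implyP[iS bad]]; exists i => //.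
apply: zariski_closure_min; first exact: zariski_closed_closure.
move=> v Uv.
suff [w [w0 wO]] : exists w : 'rV[C]_d, w != 0 /\
    forall j, e i j -> j \notin S -> dot w (row j v) = 0.
  exact: V_setD1 Uv w0 wO eG.
have [Kd|Kd] := ltnP #|neighbors e i :&: ~: S| d.
  have [w [w0 wO]] := exists_orthogonal v Kd; exists w; split=> // j ij jS.
  by apply: wO; rewrite !inE ij.
have [j jS ijS] : exists2 j, j \notin S &
    neighbors e i :&: ~: S \subset neighbors e j :&: ~: S.
  apply: contrapT => no; apply: bad; split=> // j; rewrite inE => jS.
  by apply/negP => ijS; apply: no; exists j.
exists (row j v); split=> [|l il lS].
  by apply/eqP => /(Uv.2 j).1; apply/negP.
apply: Uv.1; have /fintype.subsetP/(_ l) := ijS.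
by rewrite !inE il lS => /(_ isT)/andP[].
Qed.

(** Deleting bad vertices shrinks [S] and stops at the latest at the empty set, which is vacuously
    admissible. *)
Lemma V_sub_admissible S :
  simple_graph e -> exists2 T, admissible d e T & V C d e S `<=` V C d e T.
Proof.
move=> eG; have [m] := ubnP #|S|; elim: m S => // m IHm S Sm.
have [|/(V_nonadmissible eG)[i iS SSi]] := pselect (admissible d e S).
  by exists S.
have [|T Tadm SiT] := IHm (S :\ i)%SET.
  by move: Sm; rewrite (cardsD1 i) iS.
by exists T => // v /SSi/SiT.
Qed.

Lemma admissible_separation S i :
  forest e -> (2 <= d)%N -> i \in S -> (d <= #|neighbors e i :&: ~: S|)%N ->
  exists j : 'I_d -> 'I_n, (forall k, e i (j k)) /\
    exists2 v, U C d e S v & \det (rowsub j v) != 0.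
Proof.
move=> eF d2 iS dK; have [[e_sym e_irr] _] := eF.
pose j (k : 'I_d) := enum_val (widen_ord dK k).
have j_inj : injective j by move=> k l /enum_val_inj/(congr1 val) /= /val_inj.
have jK k : e i (j k) /\ j k \in ~: S.
  by have := enum_valP (widen_ord dK k); rewrite !inE => /andP[].
exists j; split=> [k|]; first by case: (jK k).
have [X [Xunit Xiso]] := isotropic_basis C d2.
have Xneq0 k : row k X != 0 by exact: unitmx_row_neq0.
pose g := [rel x y | [&& e x y, x \in ~: S & y \in ~: S]].
have g_sym : connect_sym g.
  apply: sym_connect_sym => x y; rewrite /= e_sym.
  by rewrite [(y \in _) && _]andbC.
pose k0 : 'I_d := Ordinal (ltn_trans (ltnSn 0) d2).
(* [c l] is the index of the chosen neighbor in the component of [l]. For components meeting none,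
   the default [k0] is fine because every basis vector is isotropic. *)
pose c l := odflt k0 [pick k | connect g (j k) l].
have cE x y : g x y -> c x = c y.
  move=> xy; congr odflt; apply: eq_pick => k /=.
  by rewrite ![connect g (j k) _]g_sym (same_connect1 g_sym xy).
(* Two chosen neighbors in one component would close a cycle through [i]. *)
have cj k : c (j k) = k.
  rewrite /c; case: pickP => [l lk|/(_ k)]; last by rewrite connect0.
  have [il lS] := jK l; have [ik _] := jK k; apply: j_inj.
  by apply: (forest_connect_neighbors eF _ il ik lS lk); rewrite inE iS.
exists (\matrix_l if l \in S then 0 else row (c l) X).
  split=> [x y xy|x]; rewrite !rowK.
    have [xS|xS] := boolP (x \in S); first by rewrite dot0l.
    have [yS|yS] := boolP (y \in S); first by rewrite dot0r.
    by rewrite (cE x y) ?Xiso //= !inE xy xS.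
  by case: ifP => // _; split=> // /eqP; rewrite (negPf (Xneq0 _)).
rewrite -unitfE -unitmxE; congr (_ \in unitmx): Xunit.
apply/row_matrixP => k; rewrite row_rowsub rowK cj; case: (jK k) => _.
by rewrite inE => /negPf->.
Qed.

Lemma V_sub_inj S T :
  forest e -> (2 <= d)%N -> admissible d e S -> V C d e S `<=` V C d e T ->
  S = T.
Proof.
move=> eF d2 Sadm ST.
(* The rows of [T] vanish on [U T], hence on its closure, which contains [U S]. *)
have TS : T \subset S.
  apply/fintype.subsetP => i iT; have [v Uv] := U_neq0 S d2.
  apply/(Uv.2 i).
  have /ST : V C d e S v by apply: sub_zariski_closure.
  move: v {Uv}; apply: zariski_closure_min; first exact: zariski_closed_row0.
  by move=> v [_ /(_ i)[_]]; apply.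
apply/eqP; rewrite finset.eqEsubset TS andbT; apply/fintype.subsetP => i iS.
apply: contraT => iT.
have [j [ij [v Uv]]] := admissible_separation eF d2 iS (Sadm i iS).1.
move=> /eqP[]; have /ST : V C d e S v by apply: sub_zariski_closure.
move: v {Uv}; apply: zariski_closure_min; first exact: zariski_closed_det.
(* On [U T] row [i] is nonzero and orthogonal to the selected neighbors: a left kernel vector of the
   transposed submatrix. *)
move=> v [vO v0] /=; apply/eqP; rewrite -det_tr; apply/det0P.
exists (row i v); first by apply/eqP => /v0; apply/negP.
apply/rowP => k; rewrite -dot_mul row_rowsub mxE; exact: vO.
Qed.

End Strata.

(** * The irreducible decomposition *)

Theorem theorem1 (R : realType) (d n : nat) (e : rel 'I_n)
    (hd : (3 <= d)%N) (hn : (1 <= n)%N) (hG : forest e) :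
  [/\ ORbar R[i] d e = \bigcup_(S in [set S | admissible d e S]) V R[i] d e S,
      forall Z : set 'M[R[i]]_(n, d),
        irreducible_component (ORbar R[i] d e) Z <->
        exists2 S : {set 'I_n}, admissible d e S & Z = V R[i] d e S
    & forall S T : {set 'I_n}, admissible d e S -> admissible d e T ->
        V R[i] d e S = V R[i] d e T -> S = T].
Proof.
have d2 : (2 <= d)%N by exact: ltnW.
have cover v : ORbar R[i] d e v ->
    exists2 S, admissible d e S & V R[i] d e S v.
  (* A point lies in the stratum of its own set of zero rows. *)
  move=> vO; pose S := [set i | row i v == 0]%SET.
  have [T Tadm ST] := V_sub_admissible R[i] d S hG.1.
  exists T => //; apply: ST; apply: sub_zariski_closure; split=> // i.
  by rewrite inE; split=> /eqP.
(* Finitely many closed sets [V S] cover, so an irreducible subset lies in one of them. *)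
have comp Z : zariski_irreducible Z -> Z `<=` ORbar R[i] d e ->
    exists2 S, admissible d e S & Z `<=` V R[i] d e S.
  move=> Zirr ZO.
  have [|S] := zariski_irreducible_sub
      (s := [seq S <- enum {set 'I_n} | `[< admissible d e S >]])
      (fun S => zariski_closed_closure (U R[i] d e S)) Zirr.
    move=> v /ZO/cover[S Sadm VSv]; exists S => //.
    by rewrite mem_filter mem_enum andbT; apply/asboolP.
  by rewrite mem_filter => /andP[/asboolP Sadm _] ZS; exists S.
split=> [|Z|S T Sadm _ ST].
- apply/seteqP; split=> v; first by move=> /cover[S]; exists S.
  by move=> [S _]; apply: V_sub_ORbar.
- split=> [[Zcl Zirr ZO Zmax]|[S Sadm ->]].
    have [S Sadm ZS] := comp Z Zirr ZO; exists S => //; apply/esym/Zmax => //.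
    - exact: zariski_closed_closure.
    - exact: V_irreducible.
    - exact: V_sub_ORbar.
  split; [exact: zariski_closed_closure|exact: V_irreducible|exact: V_sub_ORbar|].
  (* [Y] is squeezed between [V S] and [V T], and this inclusion forces [S = T]. *)
  move=> Y _ Yirr SY YO; have [T Tadm YT] := comp Y Yirr YO.
  have ST : S = T by apply: (V_sub_inj hG d2 Sadm) => v /SY/YT.
  by apply/seteqP; split=> //; rewrite ST.
- by apply: (@V_sub_inj R[i] _ _ _ _ _ hG d2 Sadm); rewrite ST.
Qed.
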